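(* Let $G$ be an edge-colored graph that is heterochromatic triangle free, and let $k\geq 6$ be an integer. If $d^c(v)\geq k$ for every vertex $v\in V(G)$, then $G$ has a heterochromatic path of length at least $\frac{3k}{4}$.
   Context: Graphs are finite and simple, with nonempty vertex set. An edge coloring of a graph $G=(V,E)$ is an arbitrary function $C:E\to\mathbb{N}$ (adjacent edges may receive the same color); $G$ together with such a coloring is an edge-colored graph, and $C(e)$ is the color of the edge $e$. The color degree $d^c(v)$ of a vertex $v$ is the number of different colors appearing on the edges incident with $v$. A subgraph (path, triangle, etc.) is heterochromatic if any two distinct edges of it have different colors. An edge-colored graph is heterochromatic triangle free if it contains no heterochromatic triangle. A path has no repeated vertices, and its length is its number of edges. *)

(* Defs.v *)
From mathcomp Require Import all_boot.

Set Implicit Arguments.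
Unset Strict Implicit.
Unset Printing Implicit Defensive.

(* A finite simple graph is a symmetric irreflexive relation e on a finType V.
   An edge is the two-element set of its ends, so a coloring C : {set V} -> nat
   is automatically independent of the orientation of an edge; every definition
   below evaluates C on edges only. *)

Section EdgeColoredGraph.

Variables (V : finType) (e : rel V) (C : {set V} -> nat).

Definition edges : {set {set V}} :=
  [set [set p.1; p.2] | p : V * V & e p.1 p.2].

Definition incident_edges (v : V) : {set {set V}} :=
  [set f in edges | v \in f].

Definition color_degree (v : V) : nat :=
  size (undup [seq C f | f in incident_edges v]).

(* F is the edge set of the subgraph under consideration. *)
Definition heterochromatic (F : {set {set V}}) : Prop :=
  {in F &, injective C}.

(* The three vertices are distinct as soon as e is irreflexive. *)
Definition triangle (x y z : V) : bool := [&& e x y, e y z & e x z].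

Definition triangle_edges (x y z : V) : {set {set V}} :=
  [set [set x; y]; [set y; z]; [set x; z]].

Definition heterochromatic_triangle_free : Prop :=
  forall x y z : V, triangle x y z -> ~ heterochromatic (triangle_edges x y z).

(* The walk x :: p has size p edges. *)
Definition simple_path (x : V) (p : seq V) : bool :=
  path e x p && uniq (x :: p).

Definition path_edges (x : V) (p : seq V) : {set {set V}} :=
  [set f in pairmap (fun u w => [set u; w]) x p].

End EdgeColoredGraph.

(* Main.v *)
(* Let P = v_0 ... v_l be a longest heterochromatic path, and call a color new
   if it does not occur on P.  Both ends of P see at least k - l new colors, all
   of them on edges to other vertices of P.

   Walk along P and look at the edges from v_0.  As no triangle
   v_0 v_t v_(t+1) is heterochromatic, a new color can neither be followed by
   another new color nor be reached from v_1 without passing a non-neighbor of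
   v_0.  So v_0 has at least k - l non-neighbors on P, and at most l - (k - l)
   colors occur between v_0 and P.

   The remaining colors at v_0 are colors of P seen on edges v_0 w with w off P.
   If v_l v_j has a new color, then c = C(v_j v_(j+1)) is not among them: otherwise
   w v_0 ... v_j v_l v_(l-1) ... v_(j+1) would be longer than P.  This excludes
   k - l colors, so k <= 2 (l - (k - l)), that is, 3 k <= 4 l. *)

Require Import Defs.
From mathcomp Require Import all_boot.
From mathcomp Require Import zify.

Set Implicit Arguments.
Unset Strict Implicit.
Unset Printing Implicit Defensive.

(** * Lists without repetition, and reversal *)

Lemma uniq_map_inj_in (T T' : eqType) (f : T -> T') (s : seq T) :
  uniq (map f s) -> {in s &, injective f}.
Proof.
elim: s => [|a s IHs] //= /andP[fa_notin us] x y.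
rewrite !inE => /predU1P[->|xs] /predU1P[->|ys] // eq_f.
- by rewrite eq_f map_f in fa_notin.
- by rewrite -eq_f map_f in fa_notin.
- exact: IHs.
Qed.

Lemma size_undup_rcons (T : eqType) (s : seq T) (a : T) :
  size (undup (rcons s a)) = size (undup s) + (a \notin s).
Proof.
have /perm_undup/perm_size -> : rcons s a =i a :: s by exact: mem_rcons.
by rewrite /=; case: ifP => _; rewrite /= ?addn0 ?addn1.
Qed.

Lemma pairmap_rev (T T' : Type) (c : T -> T -> T') (c_sym : forall x y, c x y = c y x)
    (x : T) (p : seq T) :
  pairmap c (last x p) (rev (belast x p)) = rev (pairmap c x p).
Proof.
elim: p x => [|y p IHp] x //=.
rewrite !rev_cons -IHp -!cats1 pairmap_cat /= c_sym; do 3 f_equal.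
by case: p {IHp} => //= z p; rewrite rev_cons last_rcons.
Qed.

(** * Colors at a vertex and new colors along a path *)

Section LongestHeterochromaticPath.

Variables (V : finType) (e : rel V) (C : {set V} -> nat).
Hypotheses (e_sym : symmetric e) (e_irr : irreflexive e).

Let c (x y : V) : nat := C [set x; y].

Let c_sym x y : c x y = c y x.
Proof. by rewrite /c setUC. Qed.

(** Colors are listed in path order, so that an edge of the path is addressed by its position; being
    boolean, the notion admits a search for the maximal length. *)
Definition rainbow_path (x : V) (p : seq V) : bool :=
  simple_path e x p && uniq (pairmap c x p).

Lemma heterochromatic_rainbow_path (x : V) (p : seq V) :
  rainbow_path x p -> heterochromatic C (path_edges x p).
Proof.
case/andP=> _ u f g; rewrite !inE; apply: uniq_map_inj_in.
suff -> : map C (pairmap (fun u w => [set u; w]) x p) = pairmap c x p by [].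
by elim: p x {u} => //= y p IHp x; rewrite IHp.
Qed.

Lemma rainbow_path_rev (x : V) (p : seq V) :
  rainbow_path x p -> rainbow_path (last x p) (rev (belast x p)).
Proof.
case/andP=> /andP[ep up] uc; apply/andP; split; last by rewrite pairmap_rev // rev_uniq.
apply/andP; split; last by rewrite -rev_rcons -lastI rev_uniq.
by rewrite rev_path (eq_path (e' := e)).
Qed.

Lemma triangle_colors (x y z : V) : heterochromatic_triangle_free e C ->
  e x y -> e y z -> e x z -> [|| c x y == c y z, c y z == c x z | c x y == c x z].
Proof.
move=> free exy eyz exz; apply: contraT; rewrite !negb_or => /and3P[h1 h2 h3].
case: (free x y z); first by rewrite /triangle exy eyz.
move=> f g; rewrite !inE -!orbA.
move=> /or3P[] /eqP-> /or3P[] /eqP-> //; rewrite -!/(c _ _) => eq_c.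
all: by move: h1 h2 h3; rewrite eq_c eqxx ?andbF.
Qed.

Definition end_colors (v : V) : seq nat := undup [seq c v w | w <- enum (e v)].

Lemma mem_end_colors (v : V) (a : nat) :
  reflect (exists2 w, e v w & a = c v w) (a \in end_colors v).
Proof.
rewrite mem_undup; apply: (iffP mapP) => [[w ew ->]|[w ew ->]]; exists w => //.
  by move: ew; rewrite mem_enum.
by rewrite mem_enum.
Qed.

Lemma color_degree_le (v : V) : color_degree e C v <= size (end_colors v).
Proof.
apply: uniq_leq_size (undup_uniq _) _ => a; rewrite mem_undup.
case/imageP=> f; rewrite !inE => /andP[/imsetP[[x y]]]; rewrite inE /= => exy ->.
rewrite !inE => /orP[] /eqP-> ->; apply/mem_end_colors.
  by exists y.
by exists x; rewrite 1?e_sym // c_sym.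
Qed.

(** [s] is kept apart from [p] so that an induction can run over prefixes of the path while newness
    still refers to all of it. *)
Definition new_colors (x v : V) (p s : seq V) : seq nat :=
  undup [seq c v w | w <- s & e v w && (c v w \notin pairmap c x p)].

Lemma new_colors_le_nonneighbors (x : V) (p : seq V) :
  heterochromatic_triangle_free e C -> rainbow_path x p ->
  size (new_colors x x p p) <= count (fun w => ~~ e x w) p.
Proof.
move=> free /andP[/andP[ep up] uc].
(* In the last alternative no non-neighbor is in stock, and the next new color
   has to wait for one. *)
suff inv p1 p2 : p = p1 ++ p2 ->
    let m := size (new_colors x x p p1) in
    let n := count (fun w => ~~ e x w) p1 in
    m <= n /\ [\/ m < n, p1 = [::]
      | e x (last x p1) /\ c x (last x p1) \notin pairmap c (last x p1) p2].
  by have [] := inv p [::] (esym (cats0 p)).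
elim/last_ind: p1 p2 => [|p1 y IH] p2 /=.
  by move=> _; split=> //; constructor 2.
rewrite cat_rcons => defp; have [] := IH _ defp.
have [ep1 ely ep2] : [/\ path e x p1, e (last x p1) y & path e y p2].
  by move: ep; rewrite defp cat_path /= => /and3P[].
move: uc; rewrite defp pairmap_cat cat_uniq /= => /and3P[_ _ /andP[cy_notin _]].
have cy_old : c (last x p1) y \in pairmap c x p.
  by rewrite defp pairmap_cat mem_cat inE eqxx orbT.
have later_old a : a \notin pairmap c x p -> a \notin pairmap c y p2.
  by apply: contra => ha; rewrite defp pairmap_cat mem_cat inE ha !orbT.
rewrite -defp {IH}; set m := size _; set n := count _ _ => -[le_mn IH].
have size_new : size (new_colors x x p (rcons p1 y)) =
    m + [&& e x y, c x y \notin pairmap c x p & c x y \notin new_colors x x p p1].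
  rewrite /m /new_colors filter_rcons mem_undup.
  case: (e x y) => /=; last by rewrite addn0.
  case: ifP => _ /=; last by rewrite addn0.
  by rewrite map_rcons size_undup_rcons.
have -> : count (fun w => ~~ e x w) (rcons p1 y) = n + ~~ e x y.
  by rewrite -cats1 count_cat /= addn0.
rewrite size_new last_rcons.
have [exy|_] /= := boolP (e x y); last by rewrite addn0 addn1; split; [lia|constructor 1].
rewrite addn0.
have [cxy_old|cxy_new] /= := boolP (c x y \in pairmap c x p).
  rewrite addn0; split=> //.
  case: IH => [lt_mn|p1_nil|[exl cxl_notin]]; first by constructor 1.
    by constructor 3; move: cy_notin; rewrite p1_nil.
  (* The triangle on [x], [last x p1], [y] leaves two values for [c x y]: the color of the path edge
     just crossed, which cannot recur on a rainbow path, or [c x (last x p1)], absent later by the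
     invariant. *)
  constructor 3; split=> //; move: cxl_notin; rewrite inE negb_or => /andP[neq_c cxl_notin].
  have := triangle_colors free exl ely exy; rewrite (negPf neq_c) /=.
  by case/orP => /eqP <-.
case: IH => [lt_mn|p1_nil|[exl cxl_notin]].
- by split; [lia|constructor 3; split=> //; exact: later_old].
- by move: cy_old cxy_new; rewrite p1_nil /= => ->.
move: cxl_notin; rewrite inE negb_or => /andP[neq_c _].
have := triangle_colors free exl ely exy; rewrite (negPf neq_c) /=.
case/orP=> /eqP eq_c; first by rewrite -eq_c cy_old in cxy_new.
(* The only value left for [c x y] is [c x (last x p1)], which is already counted, so [m] does not
   grow. *)
have -> : c x y \in new_colors x x p p1.
  rewrite mem_undup -eq_c; apply: map_f; rewrite mem_filter exl eq_c cxy_new /=.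
  case/lastP: p1 exl {defp ep1 ely eq_c neq_c cy_notin cy_old m n le_mn size_new} => [|q z _].
    by rewrite /= e_irr.
  by rewrite last_rcons mem_rcons mem_head.
rewrite addn0; split=> //; constructor 3; split=> //; exact: later_old.
Qed.

(** * Exchange arguments on a longest path *)

Section Longest.

Variables (x : V) (p : seq V).
Hypotheses (xp : rainbow_path x p)
  (longest : forall y q, rainbow_path y q -> size q <= size p).

(** Otherwise putting [w] in front of [x] gives a longer rainbow path. *)
Lemma new_neighbor_on_path (w : V) :
  e x w -> c x w \notin pairmap c x p -> w \in p.
Proof.
move=> exw cxw; apply: contraT => w_notin.
have := xp => /andP[/andP[ep up] uc].
suff /longest : rainbow_path w (x :: p) by rewrite /= ltnn.
rewrite /rainbow_path /simple_path /= -[_ && uniq p]/(uniq (x :: p)) up ep uc.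
rewrite e_sym exw c_sym cxw inE negb_or w_notin !andbT /=.
by apply: contraTneq exw => ->; rewrite e_irr.
Qed.

Lemma end_colors_le_new : size (end_colors x) <= size p + size (new_colors x x p p).
Proof.
rewrite -(size_pairmap c x p) -size_cat.
apply: uniq_leq_size (undup_uniq _) _ => a /mem_end_colors[w exw ->].
rewrite mem_cat; case: (boolP (c x w \in _)) => //= cxw.
rewrite mem_undup; apply: map_f.
by rewrite mem_filter exw cxw /= new_neighbor_on_path.
Qed.

(* Otherwise [w :: x :: take j p], the edge to [last x p] and the rest of [p]
   backwards form a longer path. *)
Lemma rotation_color (j : nat) (w : V) : j < size p ->
  e (last x p) (nth x (x :: p) j) ->
  c (last x p) (nth x (x :: p) j) \notin pairmap c x p ->
  e x w -> c x w = nth 0 (pairmap c x p) j -> w \in p.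
Proof.
move=> lt_jp el cl exw cxw; apply: contraT => w_notin.
have := xp => /andP[/andP[ep up] uc].
have wx : w != x by apply: contraTneq exw => ->; rewrite e_irr.
have [p1 [y [q [defp szp1]]]] : exists p1 y q, p = p1 ++ y :: q /\ size p1 = j.
  exists (take j p), (nth x p j), (drop j.+1 p).
  by rewrite -drop_nth // cat_take_drop size_takel // ltnW.
have last_p1 : nth x (x :: p) j = last x p1.
  by rewrite defp -cat_cons nth_cat /= szp1 ltnSn (last_nth x) szp1.
have cat_c : pairmap c x p = pairmap c x p1 ++ c (last x p1) y :: pairmap c y q.
  by rewrite defp pairmap_cat.
have last_p : last x p = last y q by rewrite defp last_cat.
move: cxw el cl; rewrite last_p1 last_p cat_c nth_cat size_pairmap szp1 ltnn subnn /= => cxw el cl.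
suff /longest : rainbow_path w (x :: p1 ++ rev (y :: q)).
  by rewrite defp /= !size_cat size_rev ltnn.
have perm_p : perm_eq (p1 ++ rev (y :: q)) p.
  by rewrite defp perm_cat2l perm_rev.
apply/andP; split.
  apply/andP; split; last first.
    rewrite /= !inE negb_or wx !(perm_mem perm_p) w_notin (perm_uniq perm_p) /=.
    exact: up.
  rewrite /= e_sym exw cat_path /= lastI rev_rcons /= e_sym el rev_path.
  rewrite (eq_path (e' := e)) //.
  by move: ep; rewrite defp cat_path /= => /and3P[-> _ ->].
rewrite /= pairmap_cat lastI rev_rcons /= pairmap_rev // c_sym cxw.
move: uc; rewrite cat_c => uc.
(* The edge [w x] takes over the color of the deleted edge, so the rotated path carries the colors
   of the old path and the new color of the added edge at [last x p]. *)
have perm_c (a b : nat) (s t : seq nat) : perm_eq (a :: s ++ b :: rev t) (b :: s ++ a :: t).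
  by apply/permP => P; rewrite /= !count_cat /= count_rev; lia.
by rewrite -/(uniq (_ :: _)) (perm_uniq (perm_c _ _ _ _)) cons_uniq c_sym cl.
Qed.

End Longest.

(** * Counting the colors at one end *)

Lemma longest_rainbow_path_size (x : V) (p : seq V) (k : nat) :
  heterochromatic_triangle_free e C -> (forall v, k <= color_degree e C v) ->
  rainbow_path x p -> (forall y q, rainbow_path y q -> size q <= size p) ->
  3 * k <= 4 * size p.
Proof.
move=> free deg xp longest.
set cs := pairmap c x p; set y := last x p; set r := rev (belast x p).
have size_cs : size cs = size p by rewrite size_pairmap.
have ucs : uniq cs by have /andP[] := xp.
have size_r : size r = size p by rewrite size_rev size_belast.
(* Reversal makes the bounds for a starting vertex available at the other end [y]. *)
have yr : rainbow_path y r := rainbow_path_rev xp.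
have cs_r : pairmap c y r =i cs by move=> a; rewrite pairmap_rev // mem_rev.
have ge_k v : k <= size (end_colors v) := leq_trans (deg v) (color_degree_le v).
(* [j] stands for the vertex v_j and also for the path edge v_j v_(j+1); it stops before [size p],
   where the vertex is [y] itself. *)
pose B := [seq j <- iota 0 (size p) |
  e y (nth x (x :: p) j) && (c y (nth x (x :: p) j) \notin cs)].
have size_B : k - size p <= size B.
  rewrite leq_subLR (leq_trans (ge_k y)) //.
  have longest_r z q : rainbow_path z q -> size q <= size r by rewrite size_r; exact: longest.
  apply: leq_trans (end_colors_le_new yr longest_r) _; rewrite size_r leq_add2l.
  rewrite -(size_map (fun j => c y (nth x (x :: p) j)) B).
  apply: uniq_leq_size (undup_uniq _) _ => a; rewrite mem_undup.
  case/mapP=> w; rewrite mem_filter cs_r => /andP[/andP[eyw cyw]].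
  rewrite mem_rev => /(nthP x)[j]; rewrite size_belast => lt_jp def_w ->.
  have nth_w : nth x (x :: p) j = w by rewrite lastI nth_rcons size_belast lt_jp.
  apply/mapP; exists j; last by rewrite nth_w.
  by rewrite mem_filter nth_w eyw cyw mem_iota.
pose F := [seq nth 0 cs j | j <- B].
have lt_B j : j \in B -> j < size p by rewrite mem_filter mem_iota => /andP[].
have uF : uniq F.
  rewrite map_inj_in_uniq ?filter_uniq ?iota_uniq // => i j /lt_B lt_i /lt_B lt_j /eqP.
  by rewrite nth_uniq ?size_cs // => /eqP.
(* Repetitions are kept, so that [size p - size inside] is exactly the number of non-neighbors of
   [x] on [p]. *)
pose inside := [seq c x w | w <- p & e x w].
pose outside := [seq a <- end_colors x | a \notin inside].
have size_inside : k - size p <= size p - size inside.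
  have -> : size p - size inside = count (fun w => ~~ e x w) p.
    by rewrite size_map size_filter -(count_predC (e x) p) addKn.
  apply: leq_trans (new_colors_le_nonneighbors free xp); rewrite leq_subLR.
  exact: leq_trans (ge_k x) (end_colors_le_new xp longest).
have le_inside : size inside <= size p by rewrite size_map size_filter count_size.
have size_end : size (end_colors x) <= size inside + size outside.
  rewrite -size_cat; apply: uniq_leq_size (undup_uniq _) _ => a a_end.
  by rewrite mem_cat mem_filter a_end andbT orbN.
have outsideP a : a \in outside -> exists w, [/\ e x w, a = c x w & w \notin p].
  rewrite mem_filter => /andP[a_notin /mem_end_colors[w exw def_a]].
  exists w; split=> //; apply: contra a_notin => wp.
  by rewrite def_a map_f // mem_filter exw.
(* [outside] and the colors [F] excluded by rotation are disjoint parts of [cs]. *)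
have size_outside : size outside + size F <= size p.
  rewrite -size_cat -size_cs; apply: uniq_leq_size.
    rewrite cat_uniq uF andbT filter_uniq ?undup_uniq //=.
    apply/hasPn => a /mapP[j jB def_a]; apply/negP => /outsideP[w [exw def_a' /negP[]]].
    have := jB; rewrite mem_filter => /andP[/andP[el cl] _].
    apply: (rotation_color xp longest (lt_B _ jB) el cl exw).
    by rewrite -def_a'.
  move=> a; rewrite mem_cat => /orP[/outsideP[w [exw -> w_notin]]|].
    by apply: contraNT w_notin; exact: new_neighbor_on_path.
  by case/mapP=> j /lt_B lt_j ->; rewrite mem_nth // size_cs.
move: size_outside; rewrite size_map => size_outside.
(* If [k <= size p] the bound is immediate, so the truncated subtractions do no harm. *)
have := ge_k x; lia.
Qed.

(** Tuples make the existence of a rainbow path of given length decidable; distinctness of vertices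
    bounds the length by [#|V|], and a single vertex gives length 0. *)
Lemma exists_longest_rainbow_path : 0 < #|V| ->
  exists x p, rainbow_path x p /\ forall y q, rainbow_path y q -> size q <= size p.
Proof.
case/card_gt0P=> v _.
pose P n := [exists x : V, [exists t : n.-tuple V, rainbow_path x t]].
have Pr x p : rainbow_path x p -> P (size p).
  by move=> xp; apply/existsP; exists x; apply/existsP; exists (in_tuple p).
have bound n : P n -> n <= #|V|.
  case/existsP=> x /existsP[t /andP[/andP[_ /andP[_ /card_uniqP ut]] _]].
  by rewrite -(size_tuple t) -ut max_card.
have exP : exists n, P n by exists 0; exact: (Pr v [::]).
case: (ex_maxnP exP bound) => n /existsP[x /existsP[t xt]] max_n.
exists x, t; split=> // y q /Pr; rewrite size_tuple; exact: max_n.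
Qed.

End LongestHeterochromaticPath.

Theorem theorem3p3 (V : finType) (e : rel V) (C : {set V} -> nat) (k : nat)
    (e_sym : symmetric e) (e_irr : irreflexive e) (V_nonempty : 0 < #|V|)
    (no_het_triangle : heterochromatic_triangle_free e C)
    (k_ge6 : 6 <= k)
    (min_color_degree : forall v : V, k <= color_degree e C v) :
  exists (x : V) (p : seq V),
    [/\ simple_path e x p,
        heterochromatic C (path_edges x p)
      & 3 * k <= 4 * size p].
Proof.
have [x [p [xp longest]]] := exists_longest_rainbow_path e C V_nonempty.
exists x, p; split.
- by case/andP: xp.
- exact: heterochromatic_rainbow_path xp.
- exact: (longest_rainbow_path_size e_sym e_irr no_het_triangle min_color_degree xp longest).
Qed.
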